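(* Let $n\ge m\ge 2$. Then $$\mu_{\rm o}(P_n\,\square\,P_m)=\begin{cases}2, & m=n=2,\\ 4, & (n,m)\in\{(3,2),(3,3),(4,3),(4,4)\},\\ 5, & (n,m)\in\{(5,4),(5,5),(6,4)\},\\ 6, & n=6,\ m=5,\\ m+2, & \text{otherwise}.\end{cases}$$
   Context: The grid graph $P_n\,\square\,P_m$ has vertex set $[n]\times[m]$, with $(i,j)$ adjacent to $(k,\ell)$ iff $|i-k|+|j-\ell|=1$. For a graph $G$ and $X\subseteq V(G)$, vertices $u,v\in V(G)$ are $X$-visible if there exists a shortest $u,v$-path $P$ with $V(P)\cap X\subseteq\{u,v\}$. $X$ is an outer mutual-visibility set if every two vertices of $X$ are $X$-visible and every $u\in X$, $v\in V(G)\setminus X$ are $X$-visible; $\mu_{\rm o}(G)$ is the maximum cardinality of an outer mutual-visibility set of $G$. *)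

(* Defs.v *)
From mathcomp Require Import all_boot all_order all_algebra boolp.

Set Implicit Arguments.
Unset Strict Implicit.
Unset Printing Implicit Defensive.

(* A graph on T is given by its adjacency relation e, meant to be symmetric
   and irreflexive; a path from u is the vertex sequence u :: p. *)
Definition shortest_path (T : finType) (e : rel T) (u v : T) (p : seq T)
    : Prop :=
  [/\ path e u p, last u p = v &
      forall q : seq T, path e u q -> last u q = v -> size p <= size q].

Definition visible (T : finType) (e : rel T) (X : {set T}) (u v : T) : Prop :=
  exists2 p : seq T, shortest_path e u v p &
    forall w : T, w \in u :: p -> w \in X -> w = u \/ w = v.

Definition outer_mutual_visibility (T : finType) (e : rel T) (X : {set T})
    : Prop :=
  (forall u v : T, u \in X -> v \in X -> visible e X u v) /\
  (forall u v : T, u \in X -> v \notin X -> visible e X u v).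

(* The empty set is an outer mutual-visibility set, so this is a maximum over
   a nonempty family. *)
Definition mu_o (T : finType) (e : rel T) : nat :=
  \max_(X : {set T} | `[< outer_mutual_visibility e X >]) #|X|.

Definition grid (n m : nat) : rel ('I_n * 'I_m) :=
  fun x y => (`|x.1 - y.1| + `|x.2 - y.2| == 1)%N.

Lemma grid_sym (n m : nat) : symmetric (@grid n m).
Proof. by move=> x y; rewrite /grid (distnC x.1) (distnC x.2). Qed.

Lemma grid_irr (n m : nat) : irreflexive (@grid n m).
Proof. by move=> x; rewrite /grid !distnn. Qed.

(* Main.v *)
(* Upper bound: if u in X sees v, then some neighbour of v one step closer to u
   is u itself or lies outside X. Hence two points of X in one row (column) are
   the two ends of that row (column), and two diagonally adjacent points of X
   cast shadows in which X has no further point. The first fact alone bounds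
   |X| by m + 2: outside the first row X meets each column at most once, and it
   meets the first row at most twice. In the exceptional grids other than 3 x 2,
   both facts together leave few enough candidates for a column-by-column
   search.

   Lower bound: if points of X sharing a row or a column are always corners, and
   no two points of X are diagonally adjacent, then every point of X sees every
   vertex. Such a set with m + 2 points consists of the four corners and one
   point (f j, j) for each inner column j, where f is injective, consecutive
   values of f differ by at least 2, and the first and last values of f avoid
   the rows next to the border. For m >= 6 one lets f run through the even rows
   and then the odd ones, with the last two exchanged when m is odd. *)
Require Import Defs.
From mathcomp Require Import all_boot all_order all_algebra boolp.
From mathcomp Require Import zify.

Set Implicit Arguments.
Unset Strict Implicit.
Unset Printing Implicit Defensive.

(** * Monotone lattice paths avoiding obstacles *)

Definition down_right (x y : nat * nat) : bool :=
  (y == (x.1.+1, x.2)) || (y == (x.1, x.2.+1)).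

(** The start is exempt from [O], so that concatenation tests the common vertex only once. *)
Definition mono_path (O : nat -> nat -> bool) (a b c d : nat) : Prop :=
  exists p : seq (nat * nat),
    [/\ path down_right (a, b) p, last (a, b) p = (c, d) &
        all (fun q => ~~ O q.1 q.2) p].

Lemma mono_path_trans O a b c d e f :
  mono_path O a b c d -> mono_path O c d e f -> mono_path O a b e f.
Proof.
move=> [p [pP pl pO]] [q [qP ql qO]]; exists (p ++ q).
by rewrite cat_path last_cat all_cat pl pP pO.
Qed.

Lemma mono_path_col O a b c :
  a <= c -> (forall i, a < i <= c -> ~~ O i b) -> mono_path O a b c b.
Proof.
move=> ac; rewrite -(subnKC ac); elim: (c - a) => [|t IH] H.
  by exists [::]; rewrite addn0.
apply: (@mono_path_trans _ _ _ (a + t) b); first by apply: IH => i Hi; apply: H; lia.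
exists [:: ((a + t).+1, b)]; rewrite addnS /= /down_right eqxx; split=> //.
by rewrite H //; lia.
Qed.

Lemma mono_path_row O a b d :
  b <= d -> (forall j, b < j <= d -> ~~ O a j) -> mono_path O a b a d.
Proof.
move=> bd; rewrite -(subnKC bd); elim: (d - b) => [|t IH] H.
  by exists [::]; rewrite addn0.
apply: (@mono_path_trans _ _ _ a (b + t)); first by apply: IH => i Hi; apply: H; lia.
exists [:: (a, (b + t).+1)]; rewrite addnS /= /down_right eqxx orbT; split=> //.
by rewrite H //; lia.
Qed.

(** Each step raises the coordinate sum by one and lowers no coordinate. This fixes the length and
    confines the path to its box. *)
Lemma down_right_path u p :
  path down_right u p ->
  size p + (u.1 + u.2) = (last u p).1 + (last u p).2 /\
  (forall w, w \in u :: p -> w.1 <= (last u p).1 /\ w.2 <= (last u p).2).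
Proof.
elim: p u => [|x p IH] u /=; first by split=> // w; rewrite inE => /eqP->.
case/andP=> ux /IH [Hs Hw]; have [Hx1 Hx2] := Hw x (mem_head _ _).
have [E1 E2 E3] : [/\ x.1 + x.2 = (u.1 + u.2).+1, u.1 <= x.1 & u.2 <= x.2].
  by case/orP: ux => /eqP-> /=; split; lia.
split; first by lia.
move=> w; rewrite inE => /orP [/eqP->|/Hw//].
by split; [apply: leq_trans E2 Hx1 | apply: leq_trans E3 Hx2].
Qed.

(* If the last row and the last column both meet the obstacles, scan columns
   leftwards from the obstacle of the last column: if the current one is in row
   [i], either the previous column is free down to row [i.+1], and one can pass
   below the obstacle there, or it contains an obstacle no lower than row [i],
   from which the scan goes on.
   It stops before the column of the obstacle of the last row. *)
Lemma mono_path_box (O : nat -> nat -> bool) h k :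
  (forall i1 i2 j, i1 < i2 <= h -> j <= k -> O i1 j -> O i2 j -> False) ->
  (forall i j1 j2, j1 < j2 <= k -> i <= h -> O i j1 -> O i j2 -> False) ->
  (forall i j, i < h -> j < k -> O i j.+1 -> O i.+1 j -> False) ->
  (forall i, 0 < i < h -> ~~ O i 0) -> (forall j, 0 < j < k -> ~~ O 0 j) ->
  ~~ O h k -> mono_path O 0 0 h k.
Proof.
move=> colU rowU diag col0 row0 Ohk.
have [k0|k0] := posnP k.
  rewrite k0; apply: mono_path_col => // i Hi; have [->|?] := eqVneq i h.
    by rewrite -k0.
  by apply: col0; lia.
have [h0|h0] := posnP h.
  rewrite h0; apply: mono_path_row => // i Hi; have [->|?] := eqVneq i k.
    by rewrite -h0.
  by apply: row0; lia.
have [/hasP[z] | /hasPn Hz] := boolP (has (fun i => O i k) (iota 0 h)); last first.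
  have Hz' i : i < h -> ~~ O i k by move=> ih; apply: Hz; rewrite mem_iota.
  apply: (@mono_path_trans _ _ _ 0 k).
    apply: mono_path_row => // j Hj; have [->|?] := eqVneq j k; first exact: Hz'.
    by apply: row0; lia.
  apply: mono_path_col => // i Hi; have [->//|?] := eqVneq i h.
  by apply: Hz'; lia.
rewrite mem_iota /= add0n => zh Oz.
have [/hasP[w] | /hasPn Hw] := boolP (has (fun j => O h j) (iota 0 k)); last first.
  have Hw' j : j < k -> ~~ O h j by move=> jk; apply: Hw; rewrite mem_iota.
  apply: (@mono_path_trans _ _ _ h 0).
    apply: mono_path_col => // i Hi; have [->|?] := eqVneq i h; first exact: Hw'.
    by apply: col0; lia.
  apply: mono_path_row => // i Hi; have [->//|?] := eqVneq i k.
  by apply: Hw'; lia.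
rewrite mem_iota /= add0n => wk Ow.
have bypass i j : w <= j -> j < k -> i < h -> O i j.+1 ->
    {in iota 0 i.+2, forall i', ~~ O i' j} -> mono_path O 0 0 h k.
  move=> wj jk ih Oij Hj.
  have Hj' i' : i' <= i.+1 -> ~~ O i' j by move=> ?; apply: Hj; rewrite mem_iota.
  apply: (@mono_path_trans _ _ _ 0 j).
    by apply: mono_path_row => // j' Hj''; apply: row0; lia.
  apply: (@mono_path_trans _ _ _ i.+1 j).
    by apply: mono_path_col => // i' Hi'; apply: Hj'; lia.
  apply: (@mono_path_trans _ _ _ i.+1 j.+1).
    apply: mono_path_row => // j' Hj''; have -> : j' = j.+1 by lia.
    by apply/negP => Oij'; apply: (@colU i i.+1 j.+1) => //; lia.
  apply: (@mono_path_trans _ _ _ h j.+1).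
    apply: mono_path_col => // i' Hi'.
    by apply/negP => Oij'; apply: (@colU i i' j.+1) => //; lia.
  apply: mono_path_row => // j' Hj''.
  by apply/negP => Oij'; apply: (@rowU h w j') => //; lia.
suff scan t i : w + t < k -> i < h -> O i (w + t).+1 -> mono_path O 0 0 h k.
  apply: (scan (k - w.+1) z) => //; first by lia.
  by have -> : (w + (k - w.+1)).+1 = k by lia.
elim: t i => [|t IH] i; set j := _ + _ => jk ih Oij;
  have [/hasP[i'] | /hasPn Hi'] := boolP (has (fun i' => O i' j) (iota 0 i.+2));
  rewrite ?mem_iota /= ?add0n.
- move=> i'i Oi'.
  have ? : i' != i.+1 by apply/eqP => E; apply: (diag i j) => //; rewrite -E.
  have Oi'w : O i' w by rewrite -[w]addn0.
  by case: (@colU i' h w) => //; lia.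
- by apply: (bypass i j) => //; rewrite /j; lia.
- move=> i'i Oi'.
  have : i' != i.+1 by apply/eqP => E; apply: (diag i j) => //; rewrite -E.
  by move=> ?; apply: (IH i'); rewrite -?addnS //; lia.
- by apply: (bypass i j) => //; rewrite /j; lia.
Qed.

(** * Distances, shortest paths and visibility in the grid *)

Definition grid_dist (n m : nat) (u v : 'I_n * 'I_m) : nat :=
  (`|u.1 - v.1| + `|u.2 - v.2|)%N.

(** Measuring from [a] in the direction of [c] lets one box with start [(0, 0)] serve all four
    relative positions of two vertices. *)
Definition toward (a c i : nat) : nat := if a <= c then a + i else a - i.

Lemma toward_inj (a c i j : nat) :
  i <= `|a - c|%N -> j <= `|a - c|%N -> (toward a c i == toward a c j) = (i == j).
Proof. by rewrite /toward; case: (leqP a c); lia. Qed.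

Lemma toward_succ (a c i : nat) : i < `|a - c|%N -> `|toward a c i.+1 - toward a c i|%N = 1.
Proof. by rewrite /toward; case: (leqP a c); lia. Qed.

(** A strictly monotone walk within [[0, n)] has its inner values strictly between two others. Hence
    a grid corner in the box of [u] and [v] is a corner of that box. *)
Lemma toward_border (n a c i : nat) :
  a < n -> c < n -> i <= `|a - c|%N ->
  (toward a c i == 0) || ((toward a c i).+1 == n) -> i = 0 \/ i = `|a - c|%N.
Proof. by rewrite /toward; case: (leqP a c); lia. Qed.

(** For [i <= |a - c|] the value lies between [a] and [c], so the default of [insubd] is not
    reached. *)
Definition walk (n : nat) (a c : 'I_n) (i : nat) : 'I_n :=
  insubd a (toward a c i).

Lemma val_walk (n : nat) (a c : 'I_n) i :
  i <= `|a - c|%N -> walk a c i = toward a c i :> nat.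
Proof.
move=> Hi; rewrite /walk val_insubd /toward.
by case: ifP => //; have := ltn_ord a; have := ltn_ord c; case: (leqP a c); lia.
Qed.

Lemma walk0 (n : nat) (a c : 'I_n) : walk a c 0 = a.
Proof. by apply: val_inj; rewrite /= val_walk // /toward; case: (leqP a c); lia. Qed.

Lemma walk_end (n : nat) (a c : 'I_n) : walk a c `|a - c|%N = c.
Proof. by apply: val_inj; rewrite /= val_walk // /toward; case: (leqP a c); lia. Qed.

Definition box_point (n m : nat) (u v : 'I_n * 'I_m) (q : nat * nat) :
  'I_n * 'I_m := (walk u.1 v.1 q.1, walk u.2 v.2 q.2).

Lemma grid_path_of_mono (n m : nat) (O : nat -> nat -> bool) (u v : 'I_n * 'I_m) :
  mono_path O 0 0 `|u.1 - v.1|%N `|u.2 - v.2|%N ->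
  exists p, [/\ path (@grid n m) u p, last u p = v, size p = grid_dist u v &
    forall w, w \in p -> exists2 q, w = box_point u v q & ~~ O q.1 q.2].
Proof.
case=> p [pP pl /allP pO]; exists (map (box_point u v) p).
have u0 : u = box_point u v (0, 0) by rewrite /box_point !walk0; case: u {pP pl}.
have [Hs Hb] := down_right_path pP; rewrite pl /= in Hs Hb.
split.
- rewrite {1}u0; move: pP Hb; elim: p (0, 0) {pl pO Hs} => //= q p IH r.
  case/andP=> rq qp Hb; apply/andP; split; last first.
    by apply: IH => // w wqp; apply: Hb; rewrite inE wqp orbT.
  have [r1 r2] := Hb r (mem_head _ _).
  have [q1 q2] : q.1 <= `|u.1 - v.1|%N /\ q.2 <= `|u.2 - v.2|%N.
    by apply: Hb; rewrite !inE eqxx orbT.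
  rewrite /grid /= !val_walk //.
  case/orP: rq q1 q2 => /eqP -> /= q1 q2; rewrite distnn ?addn0 ?add0n distnC.
    by rewrite toward_succ.
  by rewrite toward_succ.
- by rewrite {1}u0 last_map pl /box_point /= !walk_end; case: (v).
- by rewrite size_map /grid_dist; lia.
- by move=> w /mapP [q qp ->]; exists q => //; apply: pO.
Qed.

Lemma grid_dist_path (n m : nat) (u : 'I_n * 'I_m) p :
  path (@grid n m) u p -> grid_dist u (last u p) <= size p.
Proof.
elim: p u => [|x p IH] u /=; first by rewrite /grid_dist !distnn.
by case/andP=> + /IH; rewrite /grid /grid_dist => /eqP; lia.
Qed.

(** Without obstacles the L-shaped path attains the lower bound of [grid_dist_path]. *)
Lemma grid_shortest_size (n m : nat) (u v : 'I_n * 'I_m) p :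
  shortest_path (@grid n m) u v p -> size p = grid_dist u v.
Proof.
case=> pP pl pmin; apply/eqP; rewrite eqn_leq -{2}pl grid_dist_path // andbT.
have [|q [qP ql <- _]] := @grid_path_of_mono n m (fun _ _ => false) u v.
  by apply: (@mono_path_trans _ _ _ 0 `|u.2 - v.2|%N);
    [apply: mono_path_row | apply: mono_path_col].
exact: pmin.
Qed.

Lemma grid_visible_of_mono (n m : nat) (X : {set 'I_n * 'I_m}) u v :
  mono_path (fun i j => box_point u v (i, j) \in X :\: [set u; v])
    0 0 `|u.1 - v.1|%N `|u.2 - v.2|%N ->
  visible (@grid n m) X u v.
Proof.
case/grid_path_of_mono=> p [pP pl ps pO]; exists p.
  by split=> // q qP qv; rewrite ps -qv; exact: grid_dist_path.
move=> w; rewrite inE => /orP [/eqP->|]; first by left.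
case/pO=> q -> /=; rewrite -surjective_pairing !inE negb_and negbK => /orP [|/negP//].
by case/orP => /eqP; [left | right].
Qed.

Lemma grid_dist_step (n m : nat) (u v w : 'I_n * 'I_m) :
  grid w v -> grid_dist u v <= (grid_dist u w).+1.
Proof. by rewrite /grid /grid_dist => /eqP; lia. Qed.

(** Take the last vertex before [v] on a witnessing path: at distance at least 2 it is neither [u]
    nor [v]. The upper bounds use visibility only through this fact. *)
Lemma grid_visible_last_step (n m : nat) (X : {set 'I_n * 'I_m})
    (u v : 'I_n * 'I_m) :
  visible (@grid n m) X u v -> 2 <= grid_dist u v ->
  exists w, [/\ grid w v, (grid_dist u w).+1 = grid_dist u v & w \notin X].
Proof.
case=> p psh pX; have ps := grid_shortest_size psh.
case: psh => + + _; move: pX; rewrite -ps; case/lastP: p ps => // p v' ps.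
rewrite last_rcons rcons_path size_rcons => pX /andP [pP wv] v'v p2.
rewrite {}v'v in wv pX ps *; set w := last u p in wv.
have duw := grid_dist_path pP; rewrite -/w in duw.
have E : (grid_dist u w).+1 = grid_dist u v.
  apply/eqP; rewrite eqn_leq grid_dist_step // andbT -ps size_rcons ltnS.
  exact: duw.
exists w; rewrite E -ps size_rcons; split=> //; apply/negP => wX.
have [||Ew|Ew] := pX w => //.
- by rewrite -rcons_cons mem_rcons inE mem_last orbT.
- by move: E p2; rewrite -ps size_rcons Ew /grid_dist !distnn; lia.
- by move: E; rewrite Ew; lia.
Qed.

(** * Lower bound: spread sets *)

Definition nat_pair (n m : nat) (x : 'I_n * 'I_m) : nat * nat := (val x.1, val x.2).

Lemma nat_pair_inj (n m : nat) : injective (@nat_pair n m).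
Proof. by move=> [x1 x2] [y1 y2] [/val_inj-> /val_inj->]. Qed.

Definition corner (n m : nat) (p : nat * nat) : bool :=
  ((p.1 == 0) || (p.1.+1 == n)) && ((p.2 == 0) || (p.2.+1 == m)).

(** The relation holds for [p = q], so it can be tested over all ordered pairs of a list. *)
Definition spread (n m : nat) (p q : nat * nat) : bool :=
  [&& (p.1 == q.1) ==> (p.2 == q.2) || corner n m p && corner n m q,
      (p.2 == q.2) ==> (p.1 == q.1) || corner n m p && corner n m q &
      ~~ ((`|p.1 - q.1|%N == 1) && (`|p.2 - q.2|%N == 1))].

Lemma spreadC (n m : nat) : symmetric (spread n m).
Proof.
move=> p q; rewrite /spread !(eq_sym p.1) !(eq_sym p.2) (distnC p.1) (distnC p.2).
by rewrite (andbC (corner n m p)).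
Qed.

Lemma box_point_val (n m : nat) (u v : 'I_n * 'I_m) i j :
  i <= `|u.1 - v.1|%N -> j <= `|u.2 - v.2|%N ->
  nat_pair (box_point u v (i, j)) =
  (toward u.1 v.1 i, toward u.2 v.2 j).
Proof. by move=> Hi Hj; rewrite /nat_pair /= !val_walk. Qed.

Lemma box_point0 (n m : nat) (u v : 'I_n * 'I_m) : box_point u v (0, 0) = u.
Proof. by rewrite /box_point !walk0; case: u. Qed.

Lemma box_point_end (n m : nat) (u v : 'I_n * 'I_m) :
  box_point u v (`|u.1 - v.1|%N, `|u.2 - v.2|%N) = v.
Proof. by rewrite /box_point !walk_end; case: v. Qed.

(** Two obstacles on one line of the box would be grid corners, hence the two box corners on that
    line. One of these is [u] or [v], which are not obstacles. As [u] is in [X], the same argument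
    clears the inside of the first row and column. *)
Lemma spread_visible (n m : nat) (X : {set 'I_n * 'I_m}) (u v : 'I_n * 'I_m) :
  {in X &, forall x y, spread n m (nat_pair x) (nat_pair y)} ->
  u \in X -> visible (@grid n m) X u v.
Proof.
move=> Xs uX; apply: grid_visible_of_mono.
have in_box i j : box_point u v (i, j) \in X :\: [set u; v] ->
    [/\ box_point u v (i, j) \in X, ~~ ((i == 0) && (j == 0)) &
        ~~ ((i == `|u.1 - v.1|%N) && (j == `|u.2 - v.2|%N))].
  rewrite !inE negb_or -andbA => /and3P[nu nv ->]; split=> //.
    by apply: contra nu => /andP[/eqP-> /eqP->]; rewrite box_point0.
  by apply: contra nv => /andP[/eqP-> /eqP->]; rewrite box_point_end.
have u00 : nat_pair u = (toward u.1 v.1 0, toward u.2 v.2 0).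
  by rewrite -{1}[u](box_point0 u v) box_point_val.
apply: mono_path_box.
- move=> i1 i2 j /andP[i12 i2h] jk /in_box[X1 n1 _] /in_box[X2 _ n2].
  have i1h : i1 <= `|u.1 - v.1|%N := leq_trans (ltnW i12) i2h.
  have := Xs _ _ X1 X2; rewrite !box_point_val // => /and3P[_ + _] /=.
  rewrite eqxx toward_inj //= (ltn_eqF i12) => /andP[/andP[B1 C1] /andP[B2 _]].
  move: (toward_border (ltn_ord _) (ltn_ord _) i1h B1) n1 n2.
  move: (toward_border (ltn_ord _) (ltn_ord _) i2h B2).
  move: (toward_border (ltn_ord _) (ltn_ord _) jk C1).
  by lia.
- move=> i j1 j2 /andP[j12 j2k] ih /in_box[X1 n1 _] /in_box[X2 _ n2].
  have j1k : j1 <= `|u.2 - v.2|%N := leq_trans (ltnW j12) j2k.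
  have := Xs _ _ X1 X2; rewrite !box_point_val // => /and3P[+ _ _] /=.
  rewrite eqxx toward_inj //= (ltn_eqF j12) => /andP[/andP[C1 B1] /andP[_ B2]].
  move: (toward_border (ltn_ord _) (ltn_ord _) j1k B1) n1 n2.
  move: (toward_border (ltn_ord _) (ltn_ord _) j2k B2).
  move: (toward_border (ltn_ord _) (ltn_ord _) ih C1).
  by lia.
- move=> i j ih jk /in_box[X1 _ _] /in_box[X2 _ _].
  have := Xs _ _ X1 X2; rewrite !box_point_val ?(ltnW ih) ?(ltnW jk) //.
  by case/and3P=> _ _ /=; rewrite distnC !toward_succ.
- move=> i /andP[i0 ih]; apply/negP => /in_box[X1 _ _].
  have := Xs _ _ uX X1; rewrite u00 box_point_val ?(ltnW ih) // => /and3P[_ + _] /=.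
  rewrite eqxx toward_inj ?(ltnW ih) //= (ltn_eqF i0).
  case/andP=> _ /andP[/(toward_border (ltn_ord _) (ltn_ord _) (ltnW ih)) + _].
  by lia.
- move=> j /andP[j0 jk]; apply/negP => /in_box[X1 _ _].
  have := Xs _ _ uX X1; rewrite u00 box_point_val ?(ltnW jk) // => /and3P[+ _ _] /=.
  rewrite eqxx toward_inj ?(ltnW jk) //= (ltn_eqF j0).
  case/andP=> _ /andP[_ /(toward_border (ltn_ord _) (ltn_ord _) (ltnW jk)) +].
  by lia.
- by rewrite box_point_end !inE eqxx orbT.
Qed.

Lemma mu_o_ge_spread (n m : nat) (s : seq (nat * nat)) :
  uniq s -> {in s, forall p, (p.1 < n) && (p.2 < m)} ->
  {in s &, forall p q, spread n m p q} -> size s <= mu_o (@grid n m).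
Proof.
move=> us sb ss; pose X := [set x : 'I_n * 'I_m | nat_pair x \in s].
have XP : outer_mutual_visibility (@grid n m) X.
  have Xs : {in X &, forall x y, spread n m (nat_pair x) (nat_pair y)}.
    by move=> x y; rewrite !inE; apply: ss.
  by split=> u v uX _; apply: spread_visible.
apply: leq_trans (@leq_bigmax_cond _ _ (fun X : {set _} => #|X|) X _); last exact/asboolP.
rewrite cardE -(size_map (@nat_pair n m)); apply: uniq_leq_size => // p ps.
have /andP[p1 p2] := sb p ps.
apply/mapP; exists (Ordinal p1, Ordinal p2); last by rewrite /nat_pair -surjective_pairing.
by rewrite mem_enum inE /nat_pair -surjective_pairing.
Qed.

Definition corners (n m : nat) : seq (nat * nat) :=
  [:: (0, 0); (0, m.-1); (n.-1, 0); (n.-1, m.-1)].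

Lemma mu_o_ge_function (n m : nat) (f : nat -> nat) :
  3 <= n -> 2 <= m ->
  (forall j, 0 < j < m.-1 -> 0 < f j < n.-1) ->
  (forall i j, 0 < i < j -> j < m.-1 -> f i != f j) ->
  (forall j, 0 < j -> j.+1 < m.-1 -> `|f j - f j.+1|%N != 1) ->
  (2 < m -> 1 < f 1 < n.-2 /\ 1 < f m.-2 < n.-2) ->
  m + 2 <= mu_o (@grid n m).
Proof.
move=> n3 m2 fb finj fadj fend.
pose s := corners n m ++ [seq (f j, j) | j <- iota 1 m.-2].
have intP p : p \in [seq (f j, j) | j <- iota 1 m.-2] ->
    exists2 j, 0 < j < m.-1 & p = (f j, j).
  by case/mapP=> j; rewrite mem_iota => Hj ->; exists j => //; lia.
have corP p : p \in corners n m -> corner n m p /\ (p.1 < n) && (p.2 < m).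
  by rewrite !inE /corner => /or4P[] /eqP-> /=; lia.
have -> : m + 2 = size s by rewrite size_cat size_map size_iota /=; lia.
apply: mu_o_ge_spread.
- rewrite cat_uniq map_inj_uniq ?iota_uniq ?andbT; last by move=> ? ? [].
  apply/andP; split; first by rewrite /= !inE !xpair_eqE; lia.
  apply/hasPn => p /intP[j Hj ->]; apply/negP => /corP[].
  by rewrite /corner /=; lia.
- move=> p; rewrite mem_cat => /orP[/corP[]//|/intP[j Hj -> /=]].
  by have := fb j Hj; lia.
(* Distinct rows of corners differ by [n - 1 >= 2], so no two corners are diagonally adjacent. *)
- have cc p q : p \in corners n m -> q \in corners n m -> spread n m p q.
    move=> Hp Hq; have [[cp _] [cq _]] := (corP p Hp, corP q Hq).
    rewrite /spread cp cq !orbT !implybT /=; move: Hp Hq; rewrite !inE.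
    by case/or4P=> /eqP-> /or4P[] /eqP-> /=; lia.
  (* Only columns [1] and [m - 2] are next to a corner column; [fend] keeps their points off rows
     [1] and [n - 2]. *)
  have ci p j : p \in corners n m -> 0 < j < m.-1 -> spread n m p (f j, j).
    move=> /corP[/andP[/= p1 p2] _] Hj; have fj := fb j Hj.
    have [|f1 fm] := fend; first by lia.
    have e1 : j = 1 -> 1 < f j < n.-2 by move->.
    have em : j = m.-2 -> 1 < f j < n.-2 by move->.
    by rewrite /spread /=; apply/and3P; split; clear f1 fm; lia.
  have ii i j : 0 < i < j -> j < m.-1 -> spread n m (f i, i) (f j, j).
    move=> Hij Hj; have nf := finj i j Hij Hj; rewrite /spread /= (negPf nf) /=.
    rewrite (ltn_eqF (proj2 (andP Hij))) /=; apply/negP => /andP[+ /eqP dij].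
    have -> : j = i.+1 by lia.
    by apply/negP; apply: fadj; lia.
  move=> p q; rewrite !mem_cat => /orP[Hp|/intP[i Hi ->]] /orP[Hq|/intP[j Hj ->]].
  + exact: cc.
  + exact: ci.
  + by rewrite spreadC; apply: ci.
  + have [ij|ji|<-] := ltngtP i j; first by apply: ii; lia.
      by rewrite spreadC; apply: ii; lia.
    by rewrite /spread !eqxx !distnn.
Qed.

Lemma mu_o_ge_large (n m : nat) : 6 <= m -> m <= n -> m + 2 <= mu_o (@grid n m).
Proof.
move=> m6 mn.
have [h [o [ob [h2 mE]]]] : exists h o, o <= 1 /\ 2 <= h /\ m = (h * 2 + o).+2.
  by exists (m.-2)./2, (odd m.-2); have := odd_double_half m.-2; rewrite -muln2; case: odd; lia.
(* The values are [2, ..., 2h], then [h + o] odd rows from [1] on. Without the exchange, the last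
   value for odd [m] would be [m - 2], next to the border when [n = m]. *)
pose f j := if j <= h then j * 2
  else if (o == 1) && (j == h * 2) then h * 2 + 1
  else if (o == 1) && (j == h * 2 + 1) then h * 2 - 1
  else (j - h) * 2 - 1.
have fP j : [\/ j <= h /\ f j = j * 2, [/\ h < j, o = 1, j = h * 2 & f j = h * 2 + 1],
    [/\ h < j, o = 1, j = h * 2 + 1 & f j = h * 2 - 1] |
    [/\ h < j, o = 0 \/ j < h * 2 \/ h * 2 + 1 < j & f j = (j - h) * 2 - 1]].
  rewrite /f; case: leqP => jh; first by constructor 1.
  case: andP => [[/eqP o1 /eqP jE]|n1]; first by constructor 2.
  case: andP => [[/eqP o1 /eqP jE]|n2]; first by constructor 3.
  constructor 4; split=> //; have [o1|o1] := eqVneq o 1; last by left; lia.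
  right; have : j <> h * 2 by move=> jE; apply: n1; rewrite o1 jE !eqxx.
  have : j <> h * 2 + 1 by move=> jE; apply: n2; rewrite o1 jE !eqxx.
  by lia.
clearbody f; apply: (@mu_o_ge_function n m f); try lia.
- by move=> j Hj; case: (fP j) => -[]; lia.
- by move=> i j Hi Hj; case: (fP i) => -[]; case: (fP j) => -[]; lia.
- by move=> j Hj Hj'; case: (fP j) => -[]; case: (fP j.+1) => -[]; lia.
- by move=> _; case: (fP 1) => -[]; case: (fP m.-2) => -[]; lia.
Qed.

(** * Upper bound: local obstructions *)

Lemma visible_blocked (n m : nat) (X : {set 'I_n * 'I_m}) :
  outer_mutual_visibility (@grid n m) X ->
  forall (p : nat * nat) (c d : nat), p \in [seq nat_pair x | x in X] -> c < n -> d < m ->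
  2 <= `|p.1 - c|%N + `|p.2 - d|%N ->
  exists i j : nat, [/\ `|i - c|%N + `|j - d|%N = 1,
    (`|p.1 - i|%N + `|p.2 - j|%N).+1 = `|p.1 - c|%N + `|p.2 - d|%N &
    (i, j) \notin [seq nat_pair x | x in X]].
Proof.
move=> [XX XY] p c d /imageP[u uX ->] cn dm; pose v := (Ordinal cn, Ordinal dm).
have uv : visible (@grid n m) X u v.
  (* The two halves of outer mutual-visibility cover targets inside and outside [X]. *)
  by have [vX|vX] := boolP (v \in X); [apply: XX | apply: XY].
move=> /(grid_visible_last_step uv) [w [wv uw wX]].
exists w.1, w.2; split; [exact/eqP | exact: uw |].
apply: contra wX => /imageP[x xX E]; suff -> : w = x by [].
by apply: nat_pair_inj; rewrite -E.
Qed.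

Definition border (n i j : nat) : bool :=
  (i == 0) && (j.+1 == n) || (j == 0) && (i.+1 == n).

(* When p and q are diagonally adjacent, r cannot see the vertex opposite to it
   in the unit square spanned by p and q. *)
Definition shadowed (p q r : nat * nat) : bool :=
  (q.1 == p.1.+1) &&
  ((q.2.+1 == p.2) &&
     ((r.1 <= p.1) && (r.2 <= q.2) || (q.1 <= r.1) && (p.2 <= r.2)) ||
   (q.2 == p.2.+1) &&
     ((r.1 <= p.1) && (q.2 <= r.2) || (q.1 <= r.1) && (r.2 <= p.2))).

(** A Boolean test on lists, to be run on partial candidates. The [if] spares call-by-value
    evaluation the inner loop for most pairs. *)
Definition clean (n m : nat) (s : seq (nat * nat)) : bool :=
  all (fun p => all (fun q =>
    [&& (p.1 == q.1) ==> (p.2 == q.2) || border m p.2 q.2,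
        (p.2 == q.2) ==> (p.1 == q.1) || border n p.1 q.1 &
        if q.1 == p.1.+1 then all (fun r => ~~ shadowed p q r) s else true]) s) s.

(** If [p] and [q] share a line and some vertex lies just beyond [p], its only neighbour closer to
    [q] is [p], so [q] cannot see it. For a shadow, the two neighbours of the hidden vertex closer
    to [r] are [p] and [q]. *)
Lemma omv_clean (n m : nat) (X : {set 'I_n * 'I_m}) (s : seq (nat * nat)) :
  outer_mutual_visibility (@grid n m) X ->
  {subset s <= [seq nat_pair x | x in X]} -> clean n m s.
Proof.
move=> /visible_blocked vis sX.
have bnd (p : nat * nat) : p \in s -> p.1 < n /\ p.2 < m.
  by move=> /sX /imageP[x _ ->]; split; apply: ltn_ord.
have nin (i j : nat) (p : nat * nat) : (i, j) \notin [seq nat_pair x | x in X] -> p \in s ->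
    ~ (i = p.1 /\ j = p.2).
  by move=> + /sX; case: p => a b /negP nX ps [/= E1 E2]; apply: nX; rewrite E1 E2.
have row (p q : nat * nat) : p \in s -> q \in s -> p.1 = q.1 -> p.2 < q.2 ->
    p.2 = 0 /\ q.2.+1 = m.
  move=> ps qs E lt; have [p1 p2] := bnd p ps; have [q1 q2] := bnd q qs; split.
    apply/eqP; apply: contraT => p0.
    have [] := vis _ p.1 p.2.-1 (sX _ qs) => //; [by lia | by lia |].
    by move=> i [j [H1 H2 H3]]; have := nin _ _ _ H3 ps; lia.
  apply/eqP; apply: contraT => p0.
  have [] := vis _ q.1 q.2.+1 (sX _ ps) => //; [by lia | by lia |].
  by move=> i [j [H1 H2 H3]]; have := nin _ _ _ H3 qs; lia.
have col (p q : nat * nat) : p \in s -> q \in s -> p.2 = q.2 -> p.1 < q.1 ->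
    p.1 = 0 /\ q.1.+1 = n.
  move=> ps qs E lt; have [p1 p2] := bnd p ps; have [q1 q2] := bnd q qs; split.
    apply/eqP; apply: contraT => p0.
    have [] := vis _ p.1.-1 p.2 (sX _ qs) => //; [by lia | by lia |].
    by move=> i [j [H1 H2 H3]]; have := nin _ _ _ H3 ps; lia.
  apply/eqP; apply: contraT => p0.
  have [] := vis _ q.1.+1 q.2 (sX _ ps) => //; [by lia | by lia |].
  by move=> i [j [H1 H2 H3]]; have := nin _ _ _ H3 qs; lia.
have shad (p q r : nat * nat) : p \in s -> q \in s -> r \in s ->
    q.1 = p.1.+1 -> ~~ shadowed p q r.
  move=> ps qs rs E; apply/negP; rewrite /shadowed E eqxx /=.
  have [p1 p2] := bnd p ps; have [q1 q2] := bnd q qs; have [r1 r2] := bnd r rs.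
  case/orP => /andP[/eqP E2 /orP[]] /andP[R1 R2].
  + have [] := vis _ q.1 p.2 (sX _ rs) => //; [by lia|].
    move=> i [j [H1 H2 H3]]; have := nin _ _ _ H3 ps; have := nin _ _ _ H3 qs; lia.
  + have [] := vis _ p.1 q.2 (sX _ rs) => //; [by lia|].
    move=> i [j [H1 H2 H3]]; have := nin _ _ _ H3 ps; have := nin _ _ _ H3 qs; lia.
  + have [] := vis _ q.1 p.2 (sX _ rs) => //; [by lia|].
    move=> i [j [H1 H2 H3]]; have := nin _ _ _ H3 ps; have := nin _ _ _ H3 qs; lia.
  + have [] := vis _ p.1 q.2 (sX _ rs) => //; [by lia|].
    move=> i [j [H1 H2 H3]]; have := nin _ _ _ H3 ps; have := nin _ _ _ H3 qs; lia.
apply/allP => p ps; apply/allP => q qs; apply/and3P; split.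
- apply/implyP => /eqP E; rewrite /border; have [lt|lt|//] := ltngtP p.2 q.2.
    by have [-> ->] := row p q ps qs E lt; rewrite !eqxx.
  by have [-> ->] := row q p qs ps (esym E) lt; rewrite !eqxx orbT.
- apply/implyP => /eqP E; rewrite /border; have [lt|lt|//] := ltngtP p.1 q.1.
    by have [-> ->] := col p q ps qs E lt; rewrite !eqxx.
  by have [-> ->] := col q p qs ps (esym E) lt; rewrite !eqxx orbT.
- by case: ifP => // /eqP E; apply/allP => r rs; apply: shad.
Qed.

(** * Upper bound: column-by-column search *)

Definition column (S : pred (nat * nat)) (n j : nat) : seq nat :=
  [seq i <- iota 0 n | S (i, j)].

Definition column_options (n : nat) : seq (seq nat) :=
  [::] :: [:: 0; n.-1] :: [seq [:: i] | i <- iota 0 n].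

(** Any two entries are [0] and [n.-1]; with three, the second and third would both be [n.-1]. *)
Lemma column_optionsP (n m j : nat) (S : pred (nat * nat)) :
  (forall s : seq (nat * nat), {subset s <= S} -> clean n m s) ->
  column S n j \in column_options n.
Proof.
move=> cl; have sF : sorted ltn (column S n j).
  by apply: sorted_filter; [apply: ltn_trans | apply: iota_ltn_sorted].
have lF i : i \in column S n j -> i < n /\ S (i, j).
  by rewrite mem_filter mem_iota add0n => /andP[-> /andP[_ ->]].
have bF a b : a \in column S n j -> b \in column S n j -> a < b ->
    a = 0 /\ b.+1 = n.
  move=> /lF[_ aF] /lF[_ bF] ab; have /cl : {subset [:: (a, j); (b, j)] <= S}.
    by move=> p; rewrite !inE => /orP[] /eqP->.
  rewrite /clean /border /= => /andP[/and3P[_ /and3P[_ + _] _] _].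
  by rewrite eqxx (ltn_eqF ab) /=; lia.
move: sF lF bF; case: (column S n j) => [|a [|b [|c F]]] sF lF bF.
- by rewrite inE.
- have [an _] := lF a (mem_head _ _).
  rewrite !inE; apply/orP; right; apply/orP; right.
  by apply: map_f; rewrite mem_iota.
- have ab : a < b by move: sF => /= /andP[].
  have [-> <-] : a = 0 /\ b.+1 = n by apply: bF; rewrite ?inE ?eqxx ?orbT.
  by rewrite !inE eqxx orbT.
- have /and3P[ab bc _] : [&& a < b, b < c & path ltn c F] by [].
  have [] := bF a b; rewrite ?inE ?eqxx ?orbT //.
  have [] := bF a c; rewrite ?inE ?eqxx ?orbT //; first exact: ltn_trans bc.
  by lia.
Qed.

(** [acc] holds the points chosen in the columns from [r] on; columns are filled downwards and
    branches that are not clean are cut. *)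
Fixpoint search (n m k r : nat) (acc : seq (nat * nat)) : bool :=
  if r is r'.+1 then
    all (fun o => let acc' := [seq (i, r') | i <- o] ++ acc in
                  if clean n m acc' then search n m k r' acc' else true)
        (column_options n)
  else size acc <= k.

(** The branch following the actual columns of [S] is never cut, as its lists lie in [S]. *)
Lemma search_bound (n m k r : nat) (S : pred (nat * nat)) acc :
  (forall s : seq (nat * nat), {subset s <= S} -> clean n m s) ->
  search n m k r acc -> {subset acc <= S} ->
  size [seq (i, j) | j <- iota 0 r, i <- column S n j] + size acc <= k.
Proof.
move=> cl; elim: r acc => [|r IH] acc // Hs accS.
rewrite -[r.+1]addn1 iotaD map_cat flatten_cat size_cat /= cats0 size_map.
have acc'S : {subset [seq (i, r) | i <- column S n r] ++ acc <= S}.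
  move=> p; rewrite mem_cat => /orP[/mapP[i + ->]|/accS//].
  by rewrite mem_filter => /andP[].
have /= := allP (Hs : all _ (column_options n)) _ (column_optionsP r cl).
rewrite cl // => /IH /(_ acc'S).
by rewrite size_cat size_map addnA.
Qed.

(** * Upper bounds on [mu_o] *)

Lemma mu_o_le (n m k : nat) :
  (forall X : {set 'I_n * 'I_m}, outer_mutual_visibility (@grid n m) X -> #|X| <= k) ->
  mu_o (@grid n m) <= k.
Proof. by move=> H; apply/bigmax_leqP => X /asboolP; apply: H. Qed.

Lemma mu_o_le_search (n m k : nat) :
  search n m k m [::] -> mu_o (@grid n m) <= k.
Proof.
move=> Hs; apply: mu_o_le => X XP; pose S := [seq nat_pair x | x in X].
have := @search_bound n m k m (mem S) [::] (fun s => omv_clean XP) Hs.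
rewrite addn0 => /(_ (fun _ => ltac:(by []))); apply: leq_trans.
rewrite cardE -(size_map (@nat_pair n m)); apply: uniq_leq_size.
  by rewrite map_inj_uniq ?enum_uniq //; apply: nat_pair_inj.
move=> p pS; have /imageP[x xX pE] := pS.
apply/allpairsPdep; exists (val x.2), (val x.1).
split=> //; rewrite ?mem_filter mem_iota add0n ltn_ord ?andbT //=.
by rewrite -[(_, _)]pE.
Qed.

Lemma mu_o_le_general (n m : nat) : mu_o (@grid n m) <= m + 2.
Proof.
apply: mu_o_le => X XP.
have cl s sX := @omv_clean n m X s XP sX.
have pair x y : x \in X -> y \in X ->
    (x.1 = y.1 -> x.2 = y.2 \/ border m x.2 y.2) /\
    (x.2 = y.2 -> x.1 = y.1 \/ border n x.1 y.1).
  move=> xX yX; have /cl : {subset [:: nat_pair x; nat_pair y] <= [seq nat_pair x | x in X]}.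
    by move=> p; rewrite !inE => /orP[] /eqP->; apply: image_f.
  rewrite /clean /= => /andP[/and3P[_ /and3P[+ + _] _] _].
  move=> /implyP H1 /implyP H2; split=> E.
    by have /orP[/eqP/val_inj|] := H1 (introT eqP (congr1 val E)); [left | right].
  by have /orP[/eqP/val_inj|] := H2 (introT eqP (congr1 val E)); [left | right].
pose X0 := [set x in X | x.1 == 0 :> nat].
rewrite -(cardsID X0 X) addnC; apply: leq_add.
  (* Off the first row the column map is injective: two points in one column would include its end
     in row [0]. *)
  rewrite -[leqRHS]card_ord -(card_in_imset (f := snd)) ?max_card //.
  move=> x y; rewrite !inE => /andP[nx xX] /andP[ny yX] E.
  have [_ /(_ E)] := pair x y xX yX; rewrite xX yX /= in nx ny *.
  case=> [E'|]; first by case: x y E E' {nx xX ny yX} => ? ? [? ?] /= -> ->.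
  by rewrite /border (negPf nx) (negPf ny).
(* Two points of the first row are its opposite ends, so being in column [0] tells them apart. *)
rewrite -card_bool -(card_in_imset (f := fun x : 'I_n * 'I_m => x.2 == 0 :> nat)) ?max_card //.
move=> x y; rewrite !inE => /and3P[xX _ /eqP x0] /and3P[yX _ /eqP y0] E.
have x1y1 : x.1 = y.1 by apply: val_inj; rewrite /= x0 y0.
have [/(_ x1y1) H _] := pair x y xX yX.
have {H} : x.2 = y.2.
  case: H => // /orP[] /andP[/eqP H _]; apply/eqP; rewrite -val_eqE /= H.
    by rewrite eq_sym -E H.
  by rewrite E H.
by case: x y x1y1 {E xX yX x0 y0} => ? ? [? ?] /= -> ->.
Qed.

(** * Explicit witnesses and the case distinction *)

Lemma mu_o_ge_list (n m : nat) (s : seq (nat * nat)) :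
  [&& uniq s, all (fun p => (p.1 < n) && (p.2 < m)) s &
      all (fun p => all (spread n m p) s) s] ->
  size s <= mu_o (@grid n m).
Proof.
case/and3P=> us /allP sb /allP ss; apply: mu_o_ge_spread => // p q ps qs.
exact: (allP (ss p ps)).
Qed.

Lemma mu_o_ge_m_plus_2 (n m : nat) :
  2 <= m -> m <= n ->
  [|| (m == 2) && (3 <= n), (m == 3) && (5 <= n), (m == 4) && (7 <= n),
      (m == 5) && (7 <= n) | 6 <= m] ->
  m + 2 <= mu_o (@grid n m).
Proof.
move=> m2 mn /or4P[/andP[/eqP-> n3]|/andP[/eqP-> n5]|/andP[/eqP-> n7]|].
(* The inner columns get no row for [m = 2], then [2], then [2, 4], then [2, 5, 3]. Each bound on
   [n] makes room for the largest row. *)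
- by apply: (@mu_o_ge_function n 2 id) => //; lia.
- by apply: (@mu_o_ge_function n 3 (fun _ => 2)) => //=; lia.
- apply: (@mu_o_ge_function n 4 (fun j => j * 2)) => //=; lia.
- case/orP => [/andP[/eqP-> n7]|m6]; last exact: mu_o_ge_large.
  (* The leading [0] is a placeholder for column [0]. *)
  apply: (@mu_o_ge_function n 5 (nth 0 [:: 0; 2; 5; 3])) => //=; first by lia.
  + by case=> [|[|[|[|j]]]] //=; lia.
  + by case=> [|[|[|[|i]]]] // [|[|[|[|j]]]] //=; lia.
  + by case=> [|[|[|[|j]]]] //=; lia.
  + by lia.
Qed.

Theorem theorem4p3 (n m : nat) (hm : 2 <= m) (hnm : m <= n) :
  mu_o (@grid n m) =
    if (n, m) == (2, 2) then 2
    else if (n, m) \in [:: (3, 2); (3, 3); (4, 3); (4, 4)] then 4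
    else if (n, m) \in [:: (5, 4); (5, 5); (6, 4)] then 5
    else if (n, m) == (6, 5) then 6
    else m + 2.
Proof.
have large : [|| (m == 2) && (3 <= n), (m == 3) && (5 <= n), (m == 4) && (7 <= n),
      (m == 5) && (7 <= n) | 6 <= m] -> mu_o (@grid n m) = m + 2.
  by move=> H; apply/eqP; rewrite eqn_leq mu_o_le_general mu_o_ge_m_plus_2.
have exact_value k s : size s = k -> search n m k m [::] ->
    [&& uniq s, all (fun p => (p.1 < n) && (p.2 < m)) s &
        all (fun p => all (spread n m p) s) s] -> mu_o (@grid n m) = k.
  move=> sk /mu_o_le_search le /mu_o_ge_list ge.
  by apply/eqP; rewrite eqn_leq le -sk.
case: eqP => [[nE mE]|n1].
  (* Opposite corners are diagonally adjacent here, so two corners on one side are taken. *)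
  by subst n m; apply: (exact_value 2 [:: (0, 0); (0, 1)]); vm_compute.
case: ifP => [|n2].
  rewrite !inE !xpair_eqE => /or4P[] /andP[/eqP nE /eqP mE]; subst n m.
  (* For [(3, 2)] the value 4 is [m + 2]. *)
  - exact: large.
  - by apply: (exact_value 4 (corners 3 3)); vm_compute.
  - by apply: (exact_value 4 (corners 4 3)); vm_compute.
  - by apply: (exact_value 4 (corners 4 4)); vm_compute.
case: ifP => [|n3].
  rewrite !inE !xpair_eqE => /or3P[] /andP[/eqP nE /eqP mE]; subst n m.
  - by apply: (exact_value 5 ((2, 1) :: corners 5 4)); vm_compute.
  - by apply: (exact_value 5 ((2, 2) :: corners 5 5)); vm_compute.
  - by apply: (exact_value 5 ((2, 1) :: corners 6 4)); vm_compute.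
case: eqP => [[nE mE]|n4].
  by subst n m; apply: (exact_value 6 [:: (2, 1), (3, 3) & corners 6 5]); vm_compute.
apply: large; move: n2 n3; rewrite !inE !xpair_eqE.
have {}n1 : ~ (n = 2 /\ m = 2) by move=> [? ?]; apply: n1; congr pair.
have {}n4 : ~ (n = 6 /\ m = 5) by move=> [? ?]; apply: n4; congr pair.
by lia.
Qed.
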